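(* Let $J:=\{1,\dots,m\}$ and let $\{C_j\}_{j\in J}$ be a finite collection of nonempty union convex sets in $X$. Given $x_0\in X$, define $x_{n+1}\in T(x_n)$ for all $n\in\mathbb{N}$ in any one of the following cases. (a) (method of cyclic projections) $T=P_{C_m}\circ\dots\circ P_{C_2}\circ P_{C_1}$. (b) (cyclic Douglas--Rachford method) $T=T_{C_m,C_1}\circ\dots\circ T_{C_2,C_3}\circ T_{C_1,C_2}$ (with $m\ge2$). (c) (cyclically anchored Douglas--Rachford method) $T=T_{C_1,C_m}\circ\dots\circ T_{C_1,C_3}\circ T_{C_1,C_2}$ (with $m\ge2$). Then $\bigcap_{j\in J}C_j\subseteq\mathbf{Fix}\,T$. Moreover, if $x^*\in\mathbf{Fix}\,T$, then there exists $r>0$ such that, whenever $x_0\in\operatorname{int}\mathbb{B}(x^*;r)$, the sequence $(x_n)_{n\in\mathbb{N}}$ converges to a point $\overline{x}\in\operatorname{Fix}T\cap\mathbb{B}(x^*;r)$.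
   Context: $X$ is a real finite-dimensional Hilbert space with norm $\|\cdot\|$. A set is union convex if it is a finite union of closed convex sets. For a nonempty set $C\subseteq X$, the projector is the set-valued operator $P_C(x):=\{c\in C:\|x-c\|=\operatorname{d}(x,C)\}$, with $\operatorname{d}(x,C):=\inf_{c\in C}\|x-c\|$. For nonempty sets $A,B$, the Douglas--Rachford operator is $T_{A,B}(x):=\{x+b-a:a\in P_A(x),\ b\in P_B(2a-x)\}$. Composition of set-valued operators: $(S\circ T)(x)=\bigcup_{y\in T(x)}S(y)$. $\operatorname{Fix}T:=\{x:x\in T(x)\}$ and $\mathbf{Fix}\,T:=\{x:T(x)=\{x\}\}$. $\mathbb{B}(x;r)$ is the closed ball of center $x$ and radius $r$. *)

(* Defs.v *)
From HB Require Import structures.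
From mathcomp Require Import all_boot all_order all_algebra.
From mathcomp Require Import all_classical all_reals all_analysis.

Set Implicit Arguments.
Unset Strict Implicit.
Unset Printing Implicit Defensive.

Import Order.TTheory GRing.Theory Num.Theory.
Import numFieldNormedType.Exports.

Local Open Scope classical_set_scope.
Local Open Scope ring_scope.

#[short(type="finDimCompleteNormedModType")]
HB.structure Definition FinDimCompleteNormedModule (R : realType) :=
  {X of CompleteNormedModule R X & Vector R X}.

(* A finite-dimensional real Hilbert space is a space
   [X : finDimCompleteNormedModType R] together with an inner product
   [ip : {dot X for idfun}] such that [norm_induced_by ip]. *)
Definition norm_induced_by (R : realType) (X : finDimCompleteNormedModType R)
    (ip : {dot X for idfun}) : Prop :=
  forall x : X, `|x| = Num.sqrt (ip x x).

Section SetValuedOperators.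
Variables (R : realType) (X : normedModType R).
Implicit Types (A B C : set X) (S T : X -> set X) (x : X).

Definition union_convex C : Prop :=
  exists (n : nat) (D : 'I_n -> set X),
    (forall i, closed (D i) /\ convex_set (D i)) /\
    C = \bigcup_(i in [set: 'I_n]) D i.

Definition dist x C : R := inf [set `|x - c| | c in C].

Definition projector C : X -> set X :=
  fun x => [set c | C c /\ `|x - c| = dist x C].

Definition DR_operator A B : X -> set X :=
  fun x => [set y | exists a b,
    [/\ projector A x a, projector B (a *+ 2 - x) b & y = x + b - a]].

Definition svcomp S T : X -> set X := fun x => \bigcup_(y in T x) S y.

(* [svcomp_seq [:: T_1; ...; T_k]] is T_k \o ... \o T_1: the head of the list
   is applied first. *)
Definition svcomp_seq (s : seq (X -> set X)) : X -> set X :=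
  foldl (fun T S => svcomp S T) (fun x => [set x]) s.

Definition Fix T : set X := [set x | T x x].

Definition strongFix T : set X := [set x | T x = [set x]].

(* The sets C_1, ..., C_m are the values at 1, ..., m of [C : nat -> set X];
   the other values are irrelevant. *)
Definition cyclic_projections (m : nat) (C : nat -> set X) : X -> set X :=
  svcomp_seq [seq projector (C j) | j <- iota 1 m].

Definition cyclic_DR (m : nat) (C : nat -> set X) : X -> set X :=
  svcomp_seq (rcons [seq DR_operator (C j) (C j.+1) | j <- iota 1 m.-1]
                    (DR_operator (C m) (C 1%N))).

Definition anchored_DR (m : nat) (C : nat -> set X) : X -> set X :=
  svcomp_seq [seq DR_operator (C 1%N) (C j) | j <- iota 2 m.-1].

End SetValuedOperators.

(* Main.v *)
Require Import Defs.
From mathcomp Require Import all_boot all_order all_algebra.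
From mathcomp Require Import all_classical all_reals all_analysis.
From mathcomp Require Import ssrAC zify ring lra.
Import Order.TTheory GRing.Theory Num.Theory.
Import numFieldNormedType.Exports.
Local Open Scope classical_set_scope.
Local Open Scope ring_scope.

(** The projector onto a closed convex set is single valued and firmly
nonexpansive.  The projector onto a finite union of such sets selects, at each
point, among finitely many of these maps, and the set of points where a given
map may be selected is closed.  This structure ([union_of]) is inherited by
Douglas-Rachford operators ([union_of_DR_operator]) and by compositions
([union_of_svcomp]), provided that the class of maps is closed under
composition.  Firmly nonexpansive maps are not, so they are relaxed to
[strictly_nonexpansive] maps: nonexpansive maps that preserve the distance of
two points only if they preserve their difference.  Hence the operator [T] of
each of the three methods is a finite union of strictly nonexpansive maps
([union_of_projector], [cyclic_methods_closed]).

Let [xs] be a point with [T xs = [set xs]].  As the regions are closed and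
finitely many, there is a ball around [xs] on which every selectable map is
selectable at [xs], and so fixes [xs].  The distances from the iterates to
[xs] therefore decrease; the iterates stay in the ball and, the dimension being
finite, have a cluster point [xb], with [|xb - xs|] below all these distances.

The crucial point is that every map applied sufficiently near [xb] fixes [xb].
Indeed a strictly nonexpansive map [F] that fixes [xs] and moves [xb] satisfies
[|F xb - xs| < |xb - xs|], so by continuity it would send an iterate near [xb]
to an iterate that is closer to [xs] than [xb] is.  So once an iterate is near
[xb], the distances to [xb] decrease as well, and the whole sequence converges
to [xb].  By closedness of the regions, a map applied near [xb] is also
selectable at [xb], hence [xb] belongs to [T xb]
([union_of_local_convergence]). *)

(** * Inner products and firmly nonexpansive maps *)

Section InnerProduct.
Context {R : realType} {X : finDimCompleteNormedModType R}.
Context (ip : {dot X for idfun}) (hip : norm_induced_by ip).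
Implicit Types (a : R) (u v w x y : X).

Lemma ipC u v : ip u v = ip v u.
Proof. by rewrite [LHS]hermC expr0 mul1r. Qed.

Lemma ipBr u v w : ip u (v - w) = ip u v - ip u w.
Proof. exact: linearBr. Qed.

Lemma ipDr u v w : ip u (v + w) = ip u v + ip u w.
Proof. exact: linearDr. Qed.

Lemma ipZr a u v : ip u (a *: v) = a * ip u v.
Proof. by rewrite linearZr. Qed.

Lemma ipBl u v w : ip (u - v) w = ip u w - ip v w.
Proof. by rewrite ipC ipBr !(ipC w). Qed.

Lemma ipDl u v w : ip (u + v) w = ip u w + ip v w.
Proof. by rewrite ipC ipDr !(ipC w). Qed.

Lemma ipZl a u v : ip (a *: u) v = a * ip u v.
Proof. by rewrite ipC ipZr (ipC v). Qed.

Lemma ip_ge0 u : 0 <= ip u u.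
Proof.
have [->|u0] := eqVneq u 0; last exact/ltW/neq0_dnorm_gt0.
by have := ipBr 0 0 0; rewrite !subrr => ->.
Qed.

Lemma ip_le0 u : ip u u <= 0 -> u = 0.
Proof.
by apply: contraPeq => u0; rewrite leNgt neq0_dnorm_gt0.
Qed.

Lemma ipnormE u : ip u u = `|u| ^+ 2.
Proof. by rewrite hip sqr_sqrtr// ip_ge0. Qed.

Lemma ler_ipnorm u v : (`|u| <= `|v|) = (ip u u <= ip v v).
Proof. by rewrite !ipnormE ler_sqr// nnegrE. Qed.

Definition firmly_nonexpansive (F : X -> X) :=
  forall x y, ip (F x - F y) (F x - F y) <= ip (x - y) (F x - F y).

(** With [u], [p] and [q] the differences of the points, of the values of [F]
and of the values of [G], the gap [|u + q - p|^2 - <u, u + q - p>] is the sum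
of the gaps [|p|^2 - <u, p>] and [|q|^2 - <2p - u, q>] of [F] and [G]. *)
Lemma firmly_nonexpansive_DR (F G : X -> X) :
  firmly_nonexpansive F -> firmly_nonexpansive G ->
  firmly_nonexpansive (fun x => x + G (F x *+ 2 - x) - F x).
Proof.
move=> hF hG x y; have := hF x y; have := hG (F x *+ 2 - x) (F y *+ 2 - y).
rewrite (_ : _ - (F y *+ 2 - y) = (F x - F y) *+ 2 - (x - y)); last first.
  by rewrite mulrnBl !opprD !opprK !addrA [RHS](ACl (1*4*2*3*5)).
set q := G _ - G _; set p := F x - F y; set u := x - y.
rewrite (_ : _ + _ - F x - _ = u + q - p); last first.
  by rewrite /u /q /p !opprD !opprK !addrA [RHS](ACl (1*3*5*2*4*6)).
move: q p u => q p u.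
rewrite mulr2n !(ipBl, ipBr, ipDl, ipDr) (ipC q u) (ipC p u) (ipC q p).
nra.
Qed.

End InnerProduct.

(** * Compactness in finite dimension *)

Lemma bounded_setP (R : realType) (V : normedModType R) (A : set V) (M : R) :
  (forall u, A u -> `|u| <= M) -> bounded_set A.
Proof.
move=> bA; exists M; split; first exact: num_real.
by move=> N /ltW MN u /bA /le_trans; apply.
Qed.


Section FiniteDimension.
Import VectorInternalTheory.

(** The coordinate map is a linear isomorphism from row vectors; it is
continuous, and its norm is bounded below on the compact unit sphere of row
vectors, so bounded closed sets correspond to bounded closed sets. *)
Lemma finite_dim_bounded_closed_compact (R : realType)
    (X : finDimCompleteNormedModType R) (A : set X) :
  bounded_set A -> closed A -> compact A.
Proof.
move=> bA cA.
pose r2v : {linear 'rV[R]_(dim X) -> X} := @r2v R X.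
pose v2r : {linear X -> 'rV[R]_(dim X)} := @v2r R X.
have r2vK : cancel r2v v2r by exact: r2vK.
have v2rK : cancel v2r r2v by exact: v2rK.
have r2v_cont : continuous r2v.
  rewrite (_ : (r2v : _ -> _) = fun u => \sum_(j < dim X) u 0 j *: r2v (delta_mx 0 j)); last first.
    apply/funext => u; rewrite {1}(row_sum_delta u) linear_sum.
    by apply: eq_bigr => j _; exact: linearZ.
  apply: continuous_big => [|j _]; first exact: add_continuous.
  by move=> u; apply: cvgZr_tmp; [exact: nbhs_filter|exact: coord_continuous].
(* The constant [c] is the minimum of [`|r2v u|] over the unit sphere; in
   dimension 0 the sphere is empty and any constant will do. *)
have [c c0 r2v_ge] : exists2 c : R, 0 < c & forall u, c * `|u| <= `|r2v u|.
  pose S : set 'rV[R]_(dim X) := [set u | `|u| = 1].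
  have normalize u : u != 0 -> S (`|u|^-1 *: u).
    by move=> u0; rewrite /S /= normrZ normfV normr_id mulVf// normr_eq0.
  have [S0|/set0P/negP/negPn/eqP S0] := pselect (S !=set0); last first.
    exists 1 => // u; have [->|/normalize] := eqVneq u 0; last by rewrite S0.
    by rewrite normr0 mulr0.
  have cS : compact S.
    apply: bounded_closed_compact.
      by apply: (bounded_setP _ _ _ 1) => u ->.
    have -> : S = Num.Def.normr @^-1` [set 1] by [].
    apply: preimage_closed => [u _|]; first exact: norm_continuous.
    exact: closed_eq.
  have [|s sS smin] := compact_EVT_min (f := fun u => `|r2v u|) S0 cS.
    apply: continuous_subspaceT => u; apply: continuous_comp; first exact: r2v_cont.
    exact: norm_continuous.
  exists `|r2v s|.
    rewrite normr_gt0; apply/eqP => /(congr1 v2r); rewrite r2vK linear0 => s0.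
    by move: sS; rewrite inE /S /= s0 normr0 => /esym/eqP; rewrite oner_eq0.
  move=> u; have [->|u0] := eqVneq u 0; first by rewrite normr0 mulr0.
  have := smin _ (mem_set (normalize _ u0)).
  by rewrite linearZ normrZ normfV normr_id mulrC ler_pdivlMr ?normr_gt0.
have -> : A = r2v @` (r2v @^-1` A).
  apply/seteqP; split=> [x Ax|_ [u Au <-]//].
  by exists (v2r x); rewrite /= v2rK.
apply: continuous_compact; first exact/continuous_subspaceT.
apply: bounded_closed_compact; last by apply: preimage_closed => // u _; exact: r2v_cont.
case: bA => M [_ /(_ (M + 1) (ltr_pwDr ltr01 (lexx M))) bM].
apply: (bounded_setP _ _ _ (c^-1 * (M + 1))) => u Au.
by rewrite ler_pdivlMl// (le_trans (r2v_ge u))//; exact: bM.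
Qed.

End FiniteDimension.

(** * Projectors onto closed convex sets *)

Section Projector.
Context {R : realType} {X : normedModType R}.
Implicit Types (C : set X) (x c : X).

Lemma projectorP C x c :
  projector C x c <-> C c /\ forall d, C d -> `|x - c| <= `|x - d|.
Proof.
have lb0 : has_lbound [set `|x - d| | d in C] by exists 0 => _ [d _ <-].
split=> [[Cc ->]|[Cc cmin]]; split=> //.
  by move=> d Cd; apply: ge_inf => //; exists d.
apply/eqP; rewrite eq_le; apply/andP; split.
  by apply: lb_le_inf => [|_ [d Cd <-]]; [exists `|x - c|, c|exact: cmin].
by apply: ge_inf => //; exists c.
Qed.

Lemma projector_id C x : C x -> projector C x = [set x].
Proof.
move=> Cx; apply/seteqP; split=> [c /projectorP[_ /(_ x Cx)]|_ ->].
  by rewrite subrr normr0 normr_le0 subr_eq0 => /eqP ->.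
by apply/projectorP; split=> // d _; rewrite subrr normr0.
Qed.

End Projector.

Section ConvexProjector.
Context {R : realType} {X : finDimCompleteNormedModType R}.
Context (ip : {dot X for idfun}) (hip : norm_induced_by ip).
Implicit Types (D : set X) (x y p q d : X).

(** Only the points of [D] no farther from [x] than a given [d0] matter, and
they form a compact set. *)
Lemma projector_nonempty D x : closed D -> D !=set0 -> projector D x !=set0.
Proof.
move=> cD [d0 Dd0]; pose A := D `&` [set d | `|x - d| <= `|x - d0|].
have distc : continuous (fun d : X => `|x - d|).
  move=> d; apply: cvg_norm; apply: cvgB; [exact: cvg_cst|exact: cvg_id].
have cA : compact A.
  apply: finite_dim_bounded_closed_compact; last first.
    apply: closedI => //.
    by apply: (@preimage_closed _ _ _ [set r | r <= `|x - d0|]) => [d _|]; [exact: distc|exact: closed_le].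
  apply: (bounded_setP _ _ _ (`|x| + `|x - d0|)) => d [_ /= dA].
  rewrite -[d](subKr x).
  by rewrite (le_trans (ler_normB _ _))// lerD2l.
have [||p] := compact_EVT_min (f := fun d => `|x - d|) _ cA.
- by exists d0; split => /=.
- exact: continuous_subspaceT.
rewrite inE => -[Dp pd0] pmin; exists p; apply/projectorP; split=> // d Dd.
have [dd0|/ltW dd0] := leP `|x - d| `|x - d0|; last exact: le_trans dd0.
by apply: pmin; rewrite inE.
Qed.

(** Moving from a nearest point [p] towards [d] stays in [D], so it cannot
decrease the distance to [x] to first order. *)
Lemma projector_variational D x p d :
  convex_set D -> projector D x p -> D d -> ip (x - p) (d - p) <= 0.
Proof.
move=> convD /projectorP[Dp pmin] Dd; rewrite leNgt; apply/negP.
set a := ip _ _ => a0; pose b := ip (d - p) (d - p).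
(* The point [p + t *: (d - p)] of [D] is strictly closer to [x] than [p]
   whenever [0 < t] and [t * b < 2 * a]; here [t * (a + b) = a]. *)
have b0 : 0 <= b by exact: ip_ge0.
have t0 : 0 <= a / (a + b) by rewrite divr_ge0 ?addr_ge0// ltW.
have t1 : a / (a + b) <= 1.
  by rewrite ler_pdivrMr ?mul1r ?lerDl// ltr_wpDr.
have := convD d p (Itv01 t0 t1) (mem_set Dd) (mem_set Dp); rewrite inE => /pmin.
set t := a / (a + b) in t0 t1 *.
have -> : conv (Itv01 t0 t1) (d : convex_lmodType X) p = p + t *: (d - p) :> X.
  rewrite scalerBr addrCA -[X in _ + (X - _)]scale1r -scalerBl.
  by [].
rewrite opprD addrA (ler_ipnorm ip hip).
have tb : t * (a + b) = a by rewrite /t divfK// gt_eqF// ltr_wpDr.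
rewrite leNgt => /negP; apply.
move: (x - p) (d - p) @a @b a0 b0 t t0 t1 tb => u v a b a0 b0 t t0 t1 tb.
rewrite !(ipBl, ipBr, ipZl, ipZr) (ipC ip v u) -/a -/b.
have : 0 < t by rewrite lt_neqAle t0 andbT; apply: contraTneq a0 => t00; rewrite -tb -t00 mul0r ltxx.
nra.
Qed.

(** The sum of the variational inequalities at [p] and at [q].  For [x = y] it
gives the uniqueness of the nearest point. *)
Lemma projector_firm D x y p q : convex_set D ->
  projector D x p -> projector D y q -> ip (p - q) (p - q) <= ip (x - y) (p - q).
Proof.
move=> convD px qy.
have /projectorP[Dp _] := px; have /projectorP[Dq _] := qy.
have := projector_variational _ _ _ _ convD px Dq.
have := projector_variational _ _ _ _ convD qy Dp.
rewrite !(ipBl, ipBr) (ipC ip q p).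
lra.
Qed.

Lemma projector_closed_convex D : closed D -> convex_set D -> D !=set0 ->
  exists2 F, firmly_nonexpansive ip F & forall x, projector D x = [set F x].
Proof.
move=> cD convD D0.
have [F FP] := choice (fun x => projector_nonempty D x cD D0).
exists F => [x y|x]; first exact: projector_firm convD _ _.
apply/seteqP; split=> [p px|_ -> //]; apply/eqP; rewrite -subr_eq0; apply/eqP.
apply: (ip_le0 ip); rewrite (le_trans (projector_firm _ _ _ _ _ convD px (FP x)))//.
by rewrite !ipBl subrr.
Qed.

End ConvexProjector.

(** * Strictly nonexpansive maps *)

Section StrictlyNonexpansive.
Context {R : realType} {X : normedModType R}.
Implicit Types (F G : X -> X).

(** Every averaged nonexpansive map has this property, which keeps of
averagedness what convergence needs and is stable under composition without
any bookkeeping of constants. *)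
Definition strictly_nonexpansive F := forall x y,
  `|F x - F y| <= `|x - y| /\ (`|F x - F y| = `|x - y| -> F x - F y = x - y).

Lemma strictly_nonexpansive_id : strictly_nonexpansive id.
Proof. by []. Qed.

(** If the composite preserves the distance of [x] and [y], then so does each
factor, since neither can increase a distance. *)
Lemma strictly_nonexpansive_comp F G :
  strictly_nonexpansive F -> strictly_nonexpansive G ->
  strictly_nonexpansive (G \o F).
Proof.
move=> hF hG x y /=; have [Fle Feq] := hF x y; have [Gle Geq] := hG (F x) (F y).
split; first exact: le_trans Fle.
move=> GFeq; have Fxy : `|F x - F y| = `|x - y|.
  by apply/eqP; rewrite eq_le Fle -GFeq.
by rewrite -(Feq Fxy); apply: Geq; rewrite GFeq Fxy.
Qed.

Lemma strictly_nonexpansive_continuous F :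
  strictly_nonexpansive F -> continuous F.
Proof.
move=> hF x; apply/cvgrPdist_lt => e e0; near=> y.
rewrite (le_lt_trans (hF x y).1)//; near: y.
Unshelve. all: by end_near. Qed.

Lemma strictly_nonexpansive_lt F x y : strictly_nonexpansive F ->
  F y = y -> F x <> x -> `|F x - y| < `|x - y|.
Proof.
move=> hF Fy Fx; have [] := hF x y; rewrite Fy => le eqF.
by rewrite lt_neqAle le andbT; apply/eqP => /eqF /addIr.
Qed.

End StrictlyNonexpansive.

(** From [|p|^2 <= <u, p>] one gets [|u - p|^2 <= |u|^2 - |p|^2]. *)
Lemma firmly_strictly_nonexpansive {R : realType}
    {X : finDimCompleteNormedModType R} (ip : {dot X for idfun})
    (hip : norm_induced_by ip) (F : X -> X) :
  firmly_nonexpansive ip F -> strictly_nonexpansive F.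
Proof.
move=> hF x y; have := hF x y; move: (F x - F y) (x - y) => p u firm.
have := ip_ge0 ip (u - p).
rewrite !(ipBl, ipBr) (ipC ip p u) => up.
split; first by rewrite (ler_ipnorm ip hip); lra.
move=> pu; apply/eqP; rewrite -subr_eq0; apply/eqP/(ip_le0 ip).
have : ip p p = ip u u by rewrite !(ipnormE ip hip) pu.
rewrite !(ipBl, ipBr) (ipC ip p u) => pp.
lra.
Qed.

(** * Finite unions of single-valued maps on closed regions *)

Section UnionOf.
Context {R : realType} {X : normedModType R}.
Implicit Types (P : (X -> X) -> Prop) (S T : X -> set X).

(** The closedness of the regions [E i] states that the set of indices active at
a point is an outer semicontinuous function of the point. *)
Definition union_of P T :=
  exists (I : finType) (F : I -> X -> X) (E : I -> set X),
    [/\ forall i, P (F i), forall i, closed (E i) &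
        forall x y, T x y <-> exists2 i, E i x & F i x = y].

Lemma union_of_impl P Q T :
  (forall F, P F -> Q F) -> union_of P T -> union_of Q T.
Proof.
by move=> PQ [I [F [E [PF cE TE]]]]; exists I, F, E; split=> // i; exact/PQ.
Qed.

Lemma union_of_id P : P id -> union_of P (fun x => [set x]).
Proof.
move=> Pid; exists unit, (fun=> id), (fun=> setT); split=> [//|_|x y].
- exact: closedT.
- by split=> [->|[[] _ <-]]; first exists tt.
Qed.

(** A pair of indices is active where the first map is active and its value
lies in the region of the second; continuity keeps this region closed. *)
Lemma union_of_svcomp P S T : (forall F, P F -> continuous F) ->
    (forall F G, P F -> P G -> P (G \o F)) ->
  union_of P S -> union_of P T -> union_of P (svcomp S T).
Proof.
move=> Pcont Pcomp [J [G [D [PG cD SE]]]] [I [F [E [PF cE TE]]]].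
exists (I * J)%type, (fun k => G k.2 \o F k.1),
  (fun k => E k.1 `&` F k.1 @^-1` D k.2).
split=> [k|k|x z].
- exact: Pcomp.
- by apply: closedI => //; apply: preimage_closed => // x _; exact: (Pcont _ (PF k.1)).
- split=> [[y /TE[i Ei <-] /SE[j Dj <-]]|[[i j] /= [Ei Dj] <-]].
    by exists (i, j).
  by exists (F i x); [apply/TE; exists i|apply/SE; exists j].
Qed.

End UnionOf.

Section UnionProjector.
Context {R : realType} {X : finDimCompleteNormedModType R}.
Context (ip : {dot X for idfun}) (hip : norm_induced_by ip).

(** The projector of the piece [D i] is selectable at [x] exactly when the
point of [D i] nearest to [x] is nearest to [x] in the whole union. *)
Lemma union_of_projector (C : set X) :
  union_convex C -> union_of (firmly_nonexpansive ip) (projector C).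
Proof.
move=> [n [D [clconvD CE]]].
(* Empty pieces have no projector and are discarded. *)
pose I : finType := {i : 'I_n | `[< D i !=set0 >]}.
have DC (i : I) d : D (val i) d -> C d by rewrite CE; exists (val i).
have projD (i : I) : exists F, firmly_nonexpansive ip F /\
    forall x, projector (D (val i)) x = [set F x].
  have [cD convD] := clconvD (val i).
  have [F firmF FE] := projector_closed_convex _ hip _ cD convD (asboolW (valP i)).
  by exists F.
have [F /all_and2[firmF FE]] := choice projD.
have Fcont i : continuous (F i).
  exact/strictly_nonexpansive_continuous/(firmly_strictly_nonexpansive ip hip).
have FP i x : projector (D (val i)) x (F i x) by rewrite FE.
exists I, F, (fun i => \bigcap_(c in C) [set x | `|x - F i x| - `|x - c| <= 0]).
split=> [//|i|x p].
  apply: closed_bigI => c _.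
  apply: (@preimage_closed _ _ (fun x => `|x - F i x| - `|x - c|) [set r | r <= 0]).
    move=> x _; apply: cvgB; apply: cvg_norm; apply: cvgB.
    - exact: cvg_id.
    - exact: Fcont.
    - exact: cvg_id.
    - exact: cvg_cst.
  exact: closed_le.
split=> [/projectorP[Cp pmin]|[i Ei <-]].
  have [i _ Dp] : (\bigcup_(i in setT) D i) p by rewrite -CE.
  have i0 : `[< D i !=set0 >] by apply/asboolP; exists p.
  have Fp : F (Sub i i0) x = p.
    have : projector (D i) x p.
      by apply/projectorP; split=> // d Dd; apply: pmin; rewrite CE; exists i.
    by have -> := FE (Sub i i0) x => /= ->.
  exists (Sub i i0) => //= c Cc; rewrite /= Fp subr_le0.
  exact: pmin.
have /projectorP[DF _] := FP i x.
apply/projectorP; split; first exact: DC DF.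
by move=> c Cc; rewrite -subr_le0; exact: Ei.
Qed.

Lemma union_of_DR_operator (A B : set X) :
  union_of (firmly_nonexpansive ip) (projector A) ->
  union_of (firmly_nonexpansive ip) (projector B) ->
  union_of (firmly_nonexpansive ip) (DR_operator A B).
Proof.
move=> [I [F [E [firmF cE AE]]]] [J [G [D [firmG cD BE]]]].
have reflect_cont i : continuous (fun x => F i x *+ 2 - x).
  have Fcont : continuous (F i).
    exact/strictly_nonexpansive_continuous/(firmly_strictly_nonexpansive ip hip).
  move=> x; apply: cvgB; last exact: cvg_id.
  by rewrite mulr2n; under eq_fun do rewrite mulr2n; apply: cvgD; exact: Fcont.
exists (I * J)%type, (fun k x => x + G k.2 (F k.1 x *+ 2 - x) - F k.1 x),
  (fun k => E k.1 `&` (fun x => F k.1 x *+ 2 - x) @^-1` D k.2).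
split=> [k|k|x y].
- exact: firmly_nonexpansive_DR.
- by apply: closedI => //; apply: preimage_closed => // x _; exact: reflect_cont.
- split=> [[a [b [/AE[i Ei <-] /BE[j Dj <-] ->]]]|[[i j] /= [Ei Dj] <-]].
    by exists (i, j).
  exists (F i x), (G j (F i x *+ 2 - x)); split=> //.
    by apply/AE; exists i.
  by apply/BE; exists j.
Qed.

End UnionProjector.

(** * Local convergence of the iterates *)

Section Convergence.
Context {R : realType} {X : finDimCompleteNormedModType R}.
Implicit Types (T : X -> set X) (x y : X).

Lemma near_closed_sub (I : finType) (E : I -> set X) x :
  (forall i, closed (E i)) -> \forall y \near x, forall i, E i y -> E i x.
Proof.
move=> cE; apply: filter_forall => i.
have [Ex|nEx] := pselect (E i x); first by apply: nearW.
have : nbhs x (~` E i) by apply: open_nbhs_nbhs; split=> //; exact: closed_openC.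
by apply: filterS => y nEy /nEy.
Qed.

Lemma bounded_seq_cluster (x : nat -> X) c r : 0 < r ->
  (forall n, `|c - x n| <= r) ->
  exists2 xb, closed_ball c r xb &
    forall e N, 0 < e -> exists2 n, (N <= n)%N & `|xb - x n| < e.
Proof.
move=> r0 xr; pose B := closed_ball c r.
have xB n : B (x n) by rewrite /B closed_ballE//=; exact: xr.
have cB : compact B.
  apply: finite_dim_bounded_closed_compact; last exact: closed_ball_closed.
  apply: (bounded_setP _ _ _ (`|c| + r)) => y.
  rewrite /B closed_ballE//= => yr; rewrite -[y](subKr c).
  by rewrite (le_trans (ler_normB _ _))// lerD2l.
have [|xb [Bxb clxb]] := cB (x @ \oo) _; first by exists 0%N => // n _; exact: xB.
exists xb => // e N e0.
have [|_ [/= [n Nn <-]]] := clxb (x @` [set n | (N <= n)%N]) (ball xb e) _ (nbhsx_ballx _ _ e0).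
  by exists N => // n /= Nn; exists n.
by rewrite -ball_normE; exists n.
Qed.

(** The distances to [xs] decrease because all maps used fix [xs]; once an
iterate is near a cluster point [xb], the maps used fix [xb] too. *)
Theorem union_of_local_convergence T xs :
  union_of strictly_nonexpansive T -> strongFix T xs ->
  exists2 r : R, 0 < r & forall x : nat -> X,
    (forall n, T (x n) (x n.+1)) -> closed_ball xs r (x 0%N) ->
    exists2 xb, (Fix T `&` closed_ball xs r) xb & x n @[n --> \oo] --> xb.
Proof.
move=> [I [F [E [sF cE TE]]]] Txs.
have Fcont i : continuous (F i) by exact: strictly_nonexpansive_continuous.
have Fxs i : E i xs -> F i xs = xs.
  move=> Exs; have : T xs (F i xs) by apply/TE; exists i.
  by rewrite [T xs]Txs.
have /nbhs_ballP[e /= e0 Esub] := near_closed_sub _ _ xs cE.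
have r0 : 0 < e / 2 by rewrite divr_gt0.
(* Halving the radius puts the closed ball inside the open one. *)
exists (e / 2) => // x Tx; rewrite {1}closed_ballE//= => x0.
have /choice[k /all_and2[Ek Fk]] n : exists i, E i (x n) /\ F i (x n) = x n.+1.
  by have /TE[i Ei Fi] := Tx n; exists i.
have xr_fix n : `|xs - x n| <= e / 2 -> F (k n) xs = xs.
  move=> xr; apply/Fxs/(Esub (x n)) => //; rewrite -ball_normE /=.
  by rewrite (le_lt_trans xr)// ltr_pdivrMr// ltr_pMr// ltr1n.
have step n y : F (k n) y = y -> `|y - x n.+1| <= `|y - x n|.
  by move=> {1}<-; rewrite -Fk; exact: (sF (k n) _ _).1.
have xr n : `|xs - x n| <= e / 2.
  elim: n => // n IH; apply: (le_trans _ IH); exact/step/xr_fix.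
have kfix n : F (k n) xs = xs by exact: xr_fix.
have fejer m n : (m <= n)%N -> `|xs - x n| <= `|xs - x m|.
  move=> /subnK <-; elim: (n - m)%N => // d IH.
  by rewrite addSn (le_trans (step _ _ _)).
have [xb xbr xb_cluster] := bounded_seq_cluster x xs _ r0 xr.
(* Otherwise some iterate after [x n], close to [xb], would be farther from
   [xs] than [x n] is. *)
have xb_le n : `|xb - xs| <= `|x n - xs|.
  rewrite leNgt; apply/negP; rewrite -subr_gt0 => /(xb_cluster _ n)[m nm].
  rewrite ltrBrDr ltNge => /negP; apply.
  rewrite (distrC (x n)) (le_trans (ler_distD (x m) _ _))//.
  by rewrite lerD2l distrC fejer.
have : \forall y \near xb, (forall i, E i y -> E i xb) /\
    (forall i, F i xs = xs -> F i xb <> xb -> `|F i y - xs| < `|xb - xs|).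
  apply: filter_app (near_closed_sub _ _ xb cE).
  have : \forall y \near xb, forall i,
      F i xs = xs -> F i xb <> xb -> `|F i y - xs| < `|xb - xs|.
    apply: filter_forall => i.
    have [[Fs Fb]|nF] := pselect (F i xs = xs /\ F i xb <> xb); last first.
      by apply: nearW => y Fs Fb; case: nF.
    have : \forall y \near xb, `|F i y - xs| < `|xb - xs|.
      apply: (@cvgr_lt _ _ _ _ (fun y => `|F i y - xs|) (`|F i xb - xs|)).
        by apply: cvg_norm; apply: cvgB; [exact: Fcont|exact: cvg_cst].
      exact: strictly_nonexpansive_lt.
    by apply: filterS.
  by apply: filterS.
move=> /nbhs_ballP[d /= d0 near_xb].
(* If the map applied at [x n] moved [xb], then [x n.+1] would be closer to
   [xs] than [xb] is, against [xb_le]. *)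
have xb_fix n : `|xb - x n| < d -> E (k n) xb /\ F (k n) xb = xb.
  move=> xnd; have [|Esub' Flt] := near_xb (x n); first by rewrite -ball_normE.
  split; first exact: Esub'.
  apply: contrapT => /(Flt _ (kfix n)).
  by rewrite Fk ltNge xb_le.
exists xb.
  split=> //; have [n _ /xb_fix[Exb Fxb]] := xb_cluster d 0%N d0.
  by apply/TE; exists (k n).
apply/cvgrPdist_lt => eps eps0.
have [|N _] := xb_cluster (Num.min d eps) 0%N; first by rewrite lt_min d0.
rewrite lt_min => /andP[xNd xNeps].
have tail n : `|xb - x (n + N)%N| <= `|xb - x N|.
  elim: n => // n IH; rewrite addSn (le_trans (step _ _ _))//.
  by have [] := xb_fix _ (le_lt_trans IH xNd).
exists N => // n /= /subnK <-; exact: le_lt_trans (tail _) _.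
Qed.

End Convergence.

(** * The three methods *)

Section StrongFix.
Context {R : realType} {X : normedModType R}.
Implicit Types (A B : set X) (S T : X -> set X) (x : X).

Lemma strongFix_svcomp S T x :
  strongFix S x -> strongFix T x -> strongFix (svcomp S T) x.
Proof. by rewrite /strongFix /svcomp /= => Sx ->; rewrite bigcup_set1. Qed.

Lemma strongFix_projector A x : A x -> strongFix (projector A) x.
Proof. exact: projector_id. Qed.

Lemma strongFix_DR_operator A B x : A x -> B x -> strongFix (DR_operator A B) x.
Proof.
move=> Ax Bx; rewrite /strongFix /DR_operator /= projector_id//.
apply/seteqP; split=> [y [a [b [-> + ->]]]|_ ->].
  by rewrite mulr2n addrK projector_id// => ->; rewrite addrK.
by exists x, x; rewrite mulr2n !addrK projector_id.
Qed.

Lemma svcomp_seq_rcons (s : seq (X -> set X)) T :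
  svcomp_seq (rcons s T) = svcomp T (svcomp_seq s).
Proof. by rewrite /svcomp_seq foldl_rcons. Qed.

Lemma svcomp_seq_closed (Q : (X -> set X) -> Prop) (f : nat -> X -> set X) js :
    Q (fun x => [set x]) -> (forall S T, Q S -> Q T -> Q (svcomp S T)) ->
  (forall j, j \in js -> Q (f j)) -> Q (svcomp_seq [seq f j | j <- js]).
Proof.
move=> Qid Qcomp; elim/last_ind: js => // js j IH Qf.
rewrite map_rcons svcomp_seq_rcons; apply: Qcomp.
  by apply: Qf; rewrite mem_rcons mem_head.
by apply: IH => i ijs; apply: Qf; rewrite mem_rcons in_cons ijs orbT.
Qed.

End StrongFix.

(** The two halves of the theorem are instances: the class of operators that
strongly fix a given point, and the finite unions of strictly nonexpansive
maps. *)
Lemma cyclic_methods_closed {R : realType} {X : normedModType R}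
    (Q : (X -> set X) -> Prop) (m : nat) (C : nat -> set X) (T : X -> set X) :
    (1 <= m)%N -> Q (fun x => [set x]) ->
    (forall S S', Q S -> Q S' -> Q (svcomp S S')) ->
    (forall j, (1 <= j <= m)%N -> Q (projector (C j))) ->
    (forall i j, (1 <= i <= m)%N -> (1 <= j <= m)%N -> Q (DR_operator (C i) (C j))) ->
    [\/ T = cyclic_projections m C,
        (2 <= m)%N /\ T = cyclic_DR m C
      | (2 <= m)%N /\ T = anchored_DR m C] ->
  Q T.
Proof.
move=> m1 Qid Qcomp Qproj QDR.
case=> [->|[m2 ->]|[m2 ->]].
- by apply: svcomp_seq_closed => // j; rewrite mem_iota => jm; apply: Qproj; lia.
- rewrite /cyclic_DR svcomp_seq_rcons; apply: (Qcomp); first by apply: QDR; lia.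
  by apply: svcomp_seq_closed => // j; rewrite mem_iota => jm; apply: QDR; lia.
- by apply: svcomp_seq_closed => // j; rewrite mem_iota => jm; apply: QDR; lia.
Qed.

Theorem theorem6p1 (R : realType) (X : finDimCompleteNormedModType R)
    (ip : {dot X for idfun}) (hip : norm_induced_by ip)
    (m : nat) (hm : (1 <= m)%N) (C : nat -> set X)
    (hC : forall j, (1 <= j <= m)%N -> C j !=set0 /\ union_convex (C j))
    (T : X -> set X)
    (hT : [\/ T = cyclic_projections m C,
              (2 <= m)%N /\ T = cyclic_DR m C
            | (2 <= m)%N /\ T = anchored_DR m C]) :
  \bigcap_(j in [set j : nat | (1 <= j <= m)%N]) C j `<=` strongFix T
  /\
  forall xstar : X, strongFix T xstar ->
    exists r : R, 0 < r /\
      forall x : nat -> X,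
        (forall n, T (x n) (x n.+1)) ->
        interior (closed_ball xstar r) (x 0%N) ->
        exists xbar : X,
          (Fix T `&` closed_ball xstar r) xbar /\ x n @[n --> \oo] --> xbar.
Proof.
split=> [x Cx|xstar Txstar].
  apply: (cyclic_methods_closed (fun S => strongFix S x) m C T hm _ _ _ _ hT) => //.
  - by move=> S S'; exact: strongFix_svcomp.
  - by move=> j jm; apply: strongFix_projector; exact: Cx.
  - by move=> i j im jm; apply: strongFix_DR_operator; exact: Cx.
have firm_strict F : firmly_nonexpansive ip F -> strictly_nonexpansive F.
  exact: firmly_strictly_nonexpansive.
have projU j : (1 <= j <= m)%N -> union_of (firmly_nonexpansive ip) (projector (C j)).
  by move=> /hC[_]; exact: union_of_projector.
have TU : union_of strictly_nonexpansive T.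
  apply: (cyclic_methods_closed (union_of strictly_nonexpansive) m C T hm _ _ _ _ hT) => //.
  - exact/union_of_id/strictly_nonexpansive_id.
  - move=> S S'; apply: union_of_svcomp.
      exact: strictly_nonexpansive_continuous.
    exact: strictly_nonexpansive_comp.
  - by move=> j jm; apply: union_of_impl firm_strict (projU j jm).
  - move=> i j im jm; apply: union_of_impl firm_strict _.
    by apply: union_of_DR_operator => //; exact: projU.
have [r r0 conv_r] := union_of_local_convergence T xstar TU Txstar.
exists r; split=> // x Tx /interior_subset x0.
by have [xbar xbarP cvgx] := conv_r x Tx x0; exists xbar.
Qed.
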